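(* Let $X$ be a real Banach space, let $f:[a,b]\to X$ and $x\in[a,b]$ be such that $md(f,x)$ exists, but $f$ is not metrically differentiable at $x$. If $h$ is a homeomorphism of $[a,b]$ onto itself such that $f\circ h$ is metrically differentiable at $h^{-1}(x)$, then $md(f\circ h,h^{-1}(x))=0$.
   Context: For $f:[a,b]\to X$, the unilateral metric derivatives are $md_{\pm}(f,x)=\lim_{t\to0+}\frac{\|f(x\pm t)-f(x)\|}{t}$. If both exist and are equal (and finite), their common value is the metric derivative $md(f,x)$; at an endpoint of $[a,b]$ only the one-sided limit taken inside $[a,b]$ is used. The mapping $f$ is metrically differentiable at $x$ if $md(f,x)$ exists and $\|f(y)-f(z)\|-md(f,x)|y-z|=o(|y-x|+|z-x|)$ as $(y,z)\to(x,x)$ with $y,z\in[a,b]$. *)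

(* Defs.v *)
From HB Require Import structures.
From mathcomp Require Import all_boot all_order all_algebra.
From mathcomp Require Import all_classical all_reals all_analysis.

Set Implicit Arguments.
Unset Strict Implicit.
Unset Printing Implicit Defensive.

Import Order.TTheory GRing.Theory Num.Theory.
Import numFieldNormedType.Exports.

Local Open Scope classical_set_scope.
Local Open Scope ring_scope.

(* A mapping [a, b] -> X is represented by a total function f : R -> X; the
   notions below only depend on the restriction of f to `[a, b]. *)

Section MetricDerivative.
Context {R : realType} {X : normedModType R}.
Implicit Types (a b x l : R) (f : R -> X).

Definition is_md_right f x l : Prop :=
  `|f (x + t) - f x| / t @[t --> 0^'+] --> l.

Definition is_md_left f x l : Prop :=
  `|f (x - t) - f x| / t @[t --> 0^'+] --> l.

(* md(f, x) exists, is finite and equals l. At an endpoint only the one-sided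
   limit taken inside `[a, b] is required. *)
Definition is_md a b f x l : Prop :=
  (x < b -> is_md_right f x l) /\ (a < x -> is_md_left f x l).

Definition md_exists a b f x : Prop := exists l, is_md a b f x l.

(* The filter along which (y, z) -> (x, x) with y, z in `[a, b]. *)
Definition nbhs_pair a b x : set_system (R * R) :=
  within (`[a, b] `*` `[a, b]) (nbhs (x, x)).

#[global] Instance nbhs_pair_filter a b x : Filter (nbhs_pair a b x).
Proof. exact: within_filter. Qed.

Definition metric_differentiable a b f x : Prop :=
  exists l, is_md a b f x l /\
    let F := nbhs_pair a b x in
    (fun p : R * R => `|f p.1 - f p.2| - l * `|p.1 - p.2|)
      =o_F
    (fun p : R * R => `|p.1 - x| + `|p.2 - x|).

Lemma is_md_unique a b f x l l' : a < b -> x \in `[a, b] ->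
  is_md a b f x l -> is_md a b f x l' -> l = l'.
Proof.
move=> ab; rewrite in_itv/= => /andP[ax xb] [rl ll] [rl' ll'].
have [xb'|bx] := ltP x b.
  exact: (cvg_unique _ (rl xb') (rl' xb')).
have ax' : a < x by exact: lt_le_trans ab bx.
exact: (cvg_unique _ (ll ax') (ll' ax')).
Qed.

End MetricDerivative.

Section SelfHomeomorphism.
Context {T : ptopologicalType}.

(* The inverse of the bijection of A onto itself induced by h. *)
Definition inv_on (A : set T) (h : T -> T) : T -> T := pinv A h.

Definition self_homeomorphism (A : set T) (h : T -> T) : Prop :=
  [/\ set_bij A A h,
      {within A, continuous h} &
      {within A, continuous (inv_on A h)}].

End SelfHomeomorphism.

(* Main.v *)
(* Write g = f \o h, s = h^-1 x, u = h^-1 y, l = md(f, x) and L = md(g, s), and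
   suppose L > 0.  Comparing the two first-order expansions of
   |f y - f x| = |g u - g s| gives u - s = O(y - x) and
   L |u - s| = l |y - x| + o(|y - x|).  As h^-1 is monotone, the absolute values
   can be replaced by signed quantities with a common sign, so that
   L |u - v| = l |y - z| + o(|y - x| + |z - x|) with v = h^-1 z.  The metric
   differentiability of g at s then transfers to f at x, a contradiction. *)
Require Import Defs.
From mathcomp Require Import all_boot all_order all_algebra.
From mathcomp Require Import all_classical all_reals all_analysis.
From mathcomp Require Import unstable lra ring.
Set Implicit Arguments.
Unset Strict Implicit.
Import Order.TTheory GRing.Theory Num.Theory.
Import numFieldNormedType.Exports.
Local Open Scope classical_set_scope.
Local Open Scope ring_scope.

Lemma is_md_ge0 (R : realType) (X : normedModType R) (a b : R) (f : R -> X)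
    (x l : R) :
  a < b -> x \in `[a, b] -> is_md a b f x l -> 0 <= l.
Proof.
move=> ab; rewrite in_itv/= => /andP[ax xb] [rl ll].
have ratio_ge0 (u : R -> X) : \forall t \near 0^'+, 0 <= `|u t - f x| / t.
  by near=> t; rewrite divr_ge0.
have [xb'|bx] := ltP x b.
  exact: (cvgr_to_ge (rl xb')).
have ax' : a < x by exact: lt_le_trans ab bx.
exact: (cvgr_to_ge (ll ax')).
Unshelve. all: by end_near. Qed.

Lemma cvg_ratio_near (R : realType) (u : R -> R) (l e : R) :
  u t / t @[t --> 0^'+] --> l -> 0 < e ->
  exists2 d, 0 < d & forall t, 0 < t -> t < d -> `|u t - l * t| <= e * t.
Proof.
move=> ul e0.
have /cvgrPdist_le/(_ _ e0) := ul.
rewrite near_withinE => /nbhs_ballP[d /= d0 dP].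
exists d => // t t0 td.
have := dP t; rewrite /ball/= sub0r normrN gtr0_norm// => /(_ td t0) h.
have -> : u t - l * t = - ((l - u t / t) * t) by field; rewrite gt_eqF.
by rewrite normrN normrM (gtr0_norm t0) ler_pM2r.
Qed.

Lemma is_md_near (R : realType) (X : normedModType R) (a b : R) (f : R -> X)
    (x l e : R) :
  is_md a b f x l -> 0 < e ->
  exists2 d, 0 < d & forall y, y \in `[a, b] -> `|y - x| < d ->
    `| `|f y - f x| - l * `|y - x| | <= e * `|y - x|.
Proof.
move=> [rl ll] e0.
have [dr dr0 drP] : exists2 d, 0 < d & forall t, x < b -> 0 < t -> t < d ->
    `| `|f (x + t) - f x| - l * t| <= e * t.
  have [xb|_] := ltP x b; last by exists 1.
  by have [d d0 dP] := cvg_ratio_near (rl xb) e0; exists d => // t _; exact: dP.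
have [dl dl0 dlP] : exists2 d, 0 < d & forall t, a < x -> 0 < t -> t < d ->
    `| `|f (x - t) - f x| - l * t| <= e * t.
  have [ax|_] := ltP a x; last by exists 1.
  by have [d d0 dP] := cvg_ratio_near (ll ax) e0; exists d => // t _; exact: dP.
exists (Num.min dr dl); first by rewrite lt_min dr0.
move=> y; rewrite in_itv/= lt_min => /andP[ay yb] /andP[].
have [xy|yx|->] := ltgtP x y; last by rewrite !subrr !normr0 !mulr0 subrr normr0.
- rewrite gtr0_norm ?subr_gt0// => yd _.
  have := drP (y - x) (lt_le_trans xy yb).
  by rewrite subr_gt0 subrKC; exact.
- rewrite ltr0_norm ?subr_lt0// opprB => _ yd.
  have := dlP (x - y) (le_lt_trans ay yx).
  by rewrite subr_gt0 subKr; exact.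
Qed.

Lemma nbhs_pairP (R : realType) (a b x : R) (P : R * R -> Prop) :
  (\forall p \near nbhs_pair a b x, P p) <->
  exists2 d, 0 < d & forall y z, y \in `[a, b] -> z \in `[a, b] ->
    `|y - x| < d -> `|z - x| < d -> P (y, z).
Proof.
rewrite near_withinE; split.
  move=> /nbhs_ballP[d /= d0 dP]; exists d => // y z yab zab yd zd.
  by apply: dP; split => //; rewrite /ball/= distrC.
move=> [d d0 dP]; apply/nbhs_ballP; exists d => //= -[y z] [/= yd zd] [/= yab zab].
by apply: dP => //; rewrite distrC.
Qed.

Lemma metric_differentiableP (R : realType) (X : normedModType R) (a b : R)
    (f : R -> X) (x : R) :
  metric_differentiable a b f x <->
  exists2 l, is_md a b f x l &
    forall e, 0 < e -> exists2 d, 0 < d &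
      forall y z, y \in `[a, b] -> z \in `[a, b] ->
        `|y - x| < d -> `|z - x| < d ->
        `| `|f y - f z| - l * `|y - z| | <= e * (`|y - x| + `|z - x|).
Proof.
have sumE (y z : R) : `| `|y| + `|z| | = `|y| + `|z| by rewrite ger0_norm// addr_ge0.
split=> [[l [fl /eqoP fo]]|[l fl fo]]; exists l => //.
  move=> e e0; have /nbhs_pairP[d d0 dP] := fo e e0.
  by exists d => // y z yab zab yd zd; have := dP y z yab zab yd zd; rewrite /= sumE.
split => //=; apply/eqoP => e e0; apply/nbhs_pairP.
have [d d0 dP] := fo e e0.
by exists d => // y z yab zab yd zd; rewrite /= sumE; exact: dP.
Qed.

Lemma monotonic_sg (R : realType) (I : interval R) (k : R -> R) (x : R) :
  x \in I -> monotonic I k ->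
  exists2 s : R, `|s| = 1 & forall y, y \in I ->
    k y - k x = s * (Num.sg (y - x) * `|k y - k x|).
Proof.
move=> xI [km|km]; [exists 1|exists (-1)]; rewrite ?normrN1 ?normr1// => y yI.
- have [xy|yx|->] := ltgtP x y; last by rewrite !subrr normr0 !mulr0.
    by rewrite gtr0_sg ?subr_gt0// !mul1r ger0_norm// subr_ge0 km// ltW.
  by rewrite ltr0_sg ?subr_lt0// ler0_norm ?subr_le0 ?km 1?ltW//; ring.
- have [xy|yx|->] := ltgtP x y; last by rewrite !subrr normr0 !mulr0.
    by rewrite gtr0_sg ?subr_gt0// ler0_norm ?subr_le0 ?km 1?ltW//; ring.
  by rewrite ltr0_sg ?subr_lt0// ger0_norm ?subr_ge0 ?km 1?ltW//; ring.
Qed.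

Lemma dist_scaled_le (R : realType) (L l s p q m n d : R) :
  0 <= L -> 0 <= l -> `|s| = 1 ->
  m = s * (Num.sg p * `|m|) -> n = s * (Num.sg q * `|n|) ->
  `|L * `|m| - l * `|p| | <= d * `|p| -> `|L * `|n| - l * `|q| | <= d * `|q| ->
  `|L * `|m - n| - l * `|p - q| | <= d * (`|p| + `|q|).
Proof.
move=> L0 l0 s1 mE nE mp nq.
have signed (p' m' : R) : m' = s * (Num.sg p' * `|m'|) ->
    `|L * m' - s * (l * p')| <= `|L * `|m'| - l * `|p'| |.
  move=> m'E; rewrite {1}m'E {2}[p']numEsg.
  have -> : L * (s * (Num.sg p' * `|m'|)) - s * (l * (Num.sg p' * `|p'|)) =
      s * (Num.sg p' * (L * `|m'| - l * `|p'|)) by ring.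
  rewrite !normrM s1 mul1r normr_sg -[leRHS]mul1r.
  by apply: ler_wpM2r => //; case: (p' != 0).
have -> : L * `|m - n| = `|L * m - L * n| by rewrite -mulrBr normrM (ger0_norm L0).
have -> : l * `|p - q| = `|s * (l * p) - s * (l * q)|.
  by rewrite -!mulrBr !normrM s1 mul1r (ger0_norm l0).
apply: le_trans (ler_dist_dist _ _) _.
have -> : L * m - L * n - (s * (l * p) - s * (l * q)) =
  (L * m - s * (l * p)) - (L * n - s * (l * q)) by ring.
apply: le_trans (ler_normB _ _) _; rewrite mulrDr.
by apply: lerD; [exact: le_trans (signed _ _ mE) mp|exact: le_trans (signed _ _ nE) nq].
Qed.

(* [C] is a Lipschitz constant at [x] for the reparametrization: the two
   expansions give [L / 2 * `|m| <= N <= (l + 1) * `|p|]. *)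
Lemma md_reparam_le (R : realType) (L l e p m N : R)
    (C := 2 * (l + 1) / L) :
  0 < L -> 0 < e -> e <= 1 -> e <= L / 2 ->
  `|N - l * `|p| | <= e * `|p| -> `|N - L * `|m| | <= e * `|m| ->
  `|m| <= C * `|p| /\ `|L * `|m| - l * `|p| | <= (e * C + e) * `|p|.
Proof.
move=> L0 e0 e1 eL Np Nm.
have mC : `|m| <= C * `|p|.
  rewrite /C mulrAC ler_pdivlMr//.
  have p0 := normr_ge0 p; have m0 := normr_ge0 m.
  move: Np Nm; rewrite !ler_norml => /andP[_ Np] /andP[Nm _].
  have ep : e * `|p| <= 1 * `|p| by exact: ler_wpM2r.
  have em : e * `|m| <= L / 2 * `|m| by exact: ler_wpM2r.
  lra.
split=> //.
have -> : L * `|m| - l * `|p| = (N - l * `|p|) - (N - L * `|m|) by ring.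
apply: le_trans (ler_normB _ _) _.
rewrite mulrDl addrC; apply: lerD => //; apply: le_trans Nm _.
by rewrite -mulrA ler_wpM2l// ltW.
Qed.

Lemma metric_differentiable_reparam (R : realType) (X : normedModType R)
    (a b : R) (ab : a < b) (f g : R -> X) (k : R -> R) (x L : R) :
  x \in `[a, b] -> {in `[a, b], forall y, k y \in `[a, b]} ->
  {within `[a, b], continuous k} -> {in `[a, b] &, injective k} ->
  {in `[a, b], forall y, g (k y) = f y} ->
  md_exists a b f x -> 0 < L ->
  (forall e, 0 < e -> exists2 d, 0 < d &
      forall u v, u \in `[a, b] -> v \in `[a, b] ->
        `|u - k x| < d -> `|v - k x| < d ->
        `| `|g u - g v| - L * `|u - v| | <= e * (`|u - k x| + `|v - k x|)) ->
  metric_differentiable a b f x.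
Proof.
move=> xab kab kc kinj gk [l fl] L0 gL.
have l0 := is_md_ge0 ab xab fl.
have [s s1 ks] := monotonic_sg xab (strict_monotonicW (itv_continuous_inj_mono kc kinj)).
apply/metric_differentiableP; exists l => // e e0.
pose C := 2 * (l + 1) / L.
have C0 : 0 <= C by rewrite divr_ge0 ?mulr_ge0 ?addr_ge0// ltW.
pose r := Num.min (Num.min 1 (L / 2)) (e / (2 * C + 1)).
have r0 : 0 < r by rewrite !lt_min ltr01 !divr_gt0//; lra.
have r1 : r <= 1 by rewrite /r !ge_min lexx.
have rL : r <= L / 2 by rewrite /r !ge_min lexx orbT.
have re : r * (2 * C + 1) <= e.
  by rewrite -ler_pdivlMr ?[r]/r ?ge_min ?lexx ?orbT//; lra.
have [d1 d10 d1P] := is_md_near fl r0.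
have [d2 d20 d2P] := gL r r0.
have [d3 d30 d3P] : exists2 d, 0 < d &
    forall y, y \in `[a, b] -> `|y - x| < d -> `|k y - k x| < d2.
  have /subspace_continuousP/(_ x xab)/cvgrPdist_lt/(_ _ d20) := kc.
  rewrite near_withinE => /nbhs_ballP[d /= d0 dP]; exists d => // y yab yd.
  by rewrite distrC; apply: dP => //=; rewrite /ball/= distrC.
have reparam y : y \in `[a, b] -> `|y - x| < d1 -> `|y - x| < d3 ->
    `|k y - k x| <= C * `|y - x| /\
    `|L * `|k y - k x| - l * `|y - x| | <= (r * C + r) * `|y - x|.
  move=> yab yd1 yd3; apply: (@md_reparam_le _ _ _ _ _ _ `|f y - f x|) => //.
    exact: d1P.
  have := d2P (k y) (k x) (kab y yab) (kab x xab) (d3P y yab yd3).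
  by rewrite !gk// subrr normr0 addr0 => /(_ d20).
exists (Num.min d1 d3); first by rewrite lt_min d10.
move=> y z yab zab; rewrite !lt_min => /andP[yd1 yd3] /andP[zd1 zd3].
have [yC yl] := reparam y yab yd1 yd3.
have [zC zl] := reparam z zab zd1 zd3.
have := dist_scaled_le (ltW L0) l0 s1 (ks y yab) (ks z zab) yl zl.
have -> : k y - k x - (k z - k x) = k y - k z by ring.
have -> : y - x - (z - x) = y - z by ring.
have := d2P _ _ (kab y yab) (kab z zab) (d3P y yab yd3) (d3P z zab zd3).
rewrite !gk// => gyz kyz.
have -> : `|f y - f z| - l * `|y - z| = (`|f y - f z| - L * `|k y - k z|) +
  (L * `|k y - k z| - l * `|y - z|) by ring.
apply: le_trans (ler_normD _ _) _; apply: le_trans (lerD gyz kyz) _.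
set P := `|y - x| + `|z - x|.
have P0 : 0 <= P by rewrite addr_ge0.
have rC : r * (`|k y - k x| + `|k z - k x|) <= r * (C * P).
  by rewrite ler_wpM2l ?(ltW r0)// /P mulrDr lerD.
have : r * (2 * C + 1) * P <= e * P by exact: ler_wpM2r.
lra.
Qed.

Theorem lemma5p4 (R : realType) (X : completeNormedModType R)
  (a b : R) (ab : a < b) (f : R -> X) (x : R) (xab : x \in `[a, b])
  (fmd : md_exists a b f x) (fnd : ~ metric_differentiable a b f x)
  (h : R -> R) (hh : self_homeomorphism `[a, b] h)
  (fhd : metric_differentiable a b (f \o h) (inv_on `[a, b] h x)) :
  is_md a b (f \o h) (inv_on `[a, b] h x) 0.
Proof.
have [hbij _ kc] := hh.
have hK : {in `[a, b], cancel (inv_on `[a, b] h) h}.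
  by case: hbij => _ _ hsurj y yab; apply: (surjpK _ hsurj); rewrite inE.
have kab : {in `[a, b], forall y, inv_on `[a, b] h y \in `[a, b]}.
  by have [kfun _ _] := bijpinv_bij (fun=> point) hbij; exact: kfun.
have [L gL gLo] := (metric_differentiableP _ _ _ _).1 fhd.
have L0 : 0 <= L by exact: is_md_ge0 ab (kab x xab) gL.
have [L_gt0|L_le0] := ltP 0 L; last first.
  by have <- : L = 0 by apply/eqP; rewrite eq_le L_le0.
case: fnd.
apply: (@metric_differentiable_reparam _ _ _ _ ab f (f \o h)
  (inv_on `[a, b] h) x L) => //.
- exact: can_in_inj hK.
- by move=> y yab /=; rewrite hK.
Qed.
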